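(* Let $X$ be a real Banach space and let $Y$ be a reflexive subspace of $X$ such that the (quotient) norm of $X/Y$ is average non rough. Then the norm of $X$ is average non rough.
   Context: All Banach spaces are real. $B_{Z}$ denotes the closed unit ball of $Z$. For a Banach space $Z$, a $w^*$-slice of $B_{Z^*}$ is a set $\{z^*\in B_{Z^*}: z^*(z)>\sup_{y^*\in B_{Z^*}}y^*(z)-\alpha\}$ with $z\in Z$, $\alpha>0$. A convex combination of sets $S_1,\dots,S_n$ is $\sum_{i=1}^n\lambda_iS_i$ (Minkowski sum) with $\lambda_i>0$, $\sum_i\lambda_i=1$. For $\varepsilon>0$, the norm of $Z$ is $\varepsilon$-average rough if every convex combination of $w^*$-slices of $B_{Z^*}$ has diameter $\geq\varepsilon$. The norm of $Z$ is average non rough if it is not $\varepsilon$-average rough for any $\varepsilon>0$. *)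

(* Defs.v *)
From HB Require Import structures.
From mathcomp Require Import all_boot all_order all_algebra.
From mathcomp Require Import all_classical all_reals all_analysis.

Set Implicit Arguments.
Unset Strict Implicit.
Unset Printing Implicit Defensive.

Import Order.TTheory GRing.Theory Num.Theory.
Import numFieldNormedType.Exports.

Local Open Scope classical_set_scope.
Local Open Scope ring_scope.
Local Open Scope quotient_scope.

Section DualSpace.
Context {R : realType} (Z : normedModType R).

Definition is_dual (f : Z -> R^o) : bool := `[< linear f /\ continuous f >].

Lemma is_dual_submod_closed : submod_closed is_dual.
Proof.
split=> [|a f g]; rewrite -!topredE /=.
  apply/asboolP; split=> [b x y|]; first by rewrite scaler0 addr0.
  exact: cst_continuous.
move=> /asboolP[lf cf] /asboolP[lg cg]; apply/asboolP; split=> [b x y|x].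
  by rewrite !fctE /= lf lg !scalerDr !scalerA (mulrC a b) addrACA.
by apply: cvgD; [apply: cvgZr => //; exact: cf|exact: cg].
Qed.

Record dual := Dual { dual_fun :> Z -> R^o; dual_funP : is_dual dual_fun }.

HB.instance Definition _ := [isSub for dual_fun].
HB.instance Definition _ := [Choice of dual by <:].
HB.instance Definition _ := GRing.SubChoice_isSubLmodule.Build
  R (Z -> R^o) is_dual dual is_dual_submod_closed.

Lemma dual_linear (f : dual) : linear f.
Proof. by case: f => f /= /asboolP[]. Qed.

Lemma dual_continuous (f : dual) : continuous f.
Proof. by case: f => f /= /asboolP[]. Qed.

HB.instance Definition _ (f : dual) :=
  GRing.isLinear.Build R Z R^o _ f (@dual_linear f).

Lemma dualDE (f g : dual) z : (f + g) z = f z + g z.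
Proof. by []. Qed.

Lemma dualZE (a : R) (f : dual) z : (a *: f) z = a * f z.
Proof. by []. Qed.

Lemma dual_ext (f g : dual) : (forall z, f z = g z) -> f = g.
Proof. by move=> fg; apply: val_inj; apply/funext. Qed.

Definition dual_norm (f : dual) : R :=
  sup [set `|f z| | z in [set z : Z | `|z| <= 1]].

Lemma dual_norm_has_sup (f : dual) :
  has_sup [set `|f z| | z in [set z : Z | `|z| <= 1]].
Proof.
split; first by exists `|f 0|, 0 => //=; rewrite normr0.
have := @continuous_linear_bounded _ _ _ 0 f (@dual_continuous f 0).
move/linear_boundedP/pinfty_ex_gt0 => [M M0 fM].
exists M => _ [z /= z1 <-]; apply: (le_trans (fM z)).
by rewrite ler_piMr // ltW.
Qed.

Lemma dual_norm_ge0 (f : dual) : 0 <= dual_norm f.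
Proof.
apply: (@le_trans _ _ `|f 0|) => //.
by apply: (sup_upper_bound (dual_norm_has_sup f)); exists 0 => //=; rewrite normr0.
Qed.

Lemma dual_norm_le (f : dual) (M : R) :
  (forall z, `|z| <= 1 -> `|f z| <= M) -> dual_norm f <= M.
Proof.
move=> fM; apply: ge_sup; first by case: (dual_norm_has_sup f).
by move=> _ [z /= z1 <-]; exact: fM.
Qed.

Lemma le_dual_norm1 (f : dual) z : `|z| <= 1 -> `|f z| <= dual_norm f.
Proof. by move=> z1; apply: (sup_upper_bound (dual_norm_has_sup f)); exists z. Qed.

Lemma le_dual_norm (f : dual) z : `|f z| <= dual_norm f * `|z|.
Proof.
have [->|z0] := eqVneq z 0; first by rewrite linear0 !normr0 mulr0.
have nz : 0 < `|z| by rewrite normr_gt0.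
rewrite -ler_pdivrMr // mulrC -[X in X * _]gtr0_norm ?invr_gt0 // -normrM.
rewrite -[_ * f z]linearZ; apply: le_dual_norm1.
by rewrite normrZ gtr0_norm ?invr_gt0 // mulVf // gt_eqF.
Qed.

Fact dual_ler_normD f g : dual_norm (f + g) <= dual_norm f + dual_norm g.
Proof.
apply: dual_norm_le => z z1; rewrite dualDE (le_trans (ler_normD _ _)) //.
by rewrite lerD // le_dual_norm1.
Qed.

Fact dual_normrZ (a : R) f : dual_norm (a *: f) = `|a| * dual_norm f.
Proof.
have le b g : dual_norm (b *: g) <= `|b| * dual_norm g.
  apply: dual_norm_le => z z1.
  by rewrite dualZE normrM ler_wpM2l // le_dual_norm1.
apply/eqP; rewrite eq_le le /=.
have [->|a0] := eqVneq a 0; first by rewrite normr0 mul0r dual_norm_ge0.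
rewrite -ler_pdivlMl ?normr_gt0 // -normfV (le_trans _ (le _ _)) //.
by rewrite scalerA mulVf // scale1r.
Qed.

Fact dual_normr0_eq0 f : dual_norm f = 0 -> f = 0.
Proof.
move=> f0; apply: dual_ext => z; apply/eqP; rewrite -normr_le0.
by rewrite (le_trans (le_dual_norm _ _)) // f0 mul0r.
Qed.

HB.instance Definition _ := Lmodule_isNormed.Build R dual
  dual_ler_normD dual_normrZ dual_normr0_eq0.

End DualSpace.

(* Surjectivity of the canonical map z |-> (f |-> f z) from Z to its bidual. *)
Definition reflexive_space {R : realType} (Z : normedModType R) : Prop :=
  forall F : dual (dual Z), exists z : Z, forall f : dual Z, F f = f z.

(* A subspace is bundled with its closedness, without which the quotient carries
   only a seminorm; a reflexive subspace is complete, hence always closed. *)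
Record closedSubspace {R : realType} (X : normedModType R) := ClosedSubspace {
  subspace_pred :> {pred X};
  subspace_submod_closed : submod_closed subspace_pred;
  subspace_closed : closed [set` subspace_pred]
}.

HB.instance Definition _ (R : realType) (X : normedModType R)
    (Y : closedSubspace X) :=
  GRing.isSubmodClosed.Build R X (subspace_pred Y) (subspace_submod_closed Y).

Section Subspace.
Context {R : realType} {X : normedModType R} (Y : closedSubspace X).

Definition subspace_of : Type := {x : X | x \in Y}.

HB.instance Definition _ := SubChoice.on subspace_of.
HB.instance Definition _ := [SubChoice_isSubLmodule of subspace_of by <:].

Definition subspace_norm (y : subspace_of) : R := `|val y|.

Fact subspace_ler_normD x y :
  subspace_norm (x + y) <= subspace_norm x + subspace_norm y.
Proof. by rewrite /subspace_norm raddfD ler_normD. Qed.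

Fact subspace_normrZ (a : R) x : subspace_norm (a *: x) = `|a| * subspace_norm x.
Proof. by rewrite /subspace_norm linearZ normrZ. Qed.

Fact subspace_normr0_eq0 x : subspace_norm x = 0 -> x = 0.
Proof. by move/normr0_eq0 => x0; apply: val_inj; rewrite x0 raddf0. Qed.

HB.instance Definition _ := Lmodule_isNormed.Build R subspace_of
  subspace_ler_normD subspace_normrZ subspace_normr0_eq0.

End Subspace.

Section QuotientSpace.
Context {R : realType} {X : normedModType R} (Y : closedSubspace X).

Definition quotient_space : Type := Quotient.quot Y.

HB.instance Definition _ := GRing.Zmodule.on quotient_space.

Definition quotient_proj (x : X) : quotient_space := \pi_(Quotient.quot Y) x.

Lemma quotient_projP x x' :
  quotient_proj x = quotient_proj x' <-> x - x' \in Y.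
Proof. by rewrite Quotient.idealrBE; split=> [/eqP|/eqP]. Qed.

Lemma quotient_proj_surj q : exists x, quotient_proj x = q.
Proof. by exists (repr q); exact: reprK. Qed.

Lemma quotient_projD : {morph quotient_proj : x y / x + y}.
Proof. by move=> x y; exact: (Quotient.pi_add Y). Qed.

Definition quotient_scale (a : R) (q : quotient_space) : quotient_space :=
  quotient_proj (a *: repr q).

Lemma quotient_scale_proj a x :
  quotient_scale a (quotient_proj x) = quotient_proj (a *: x).
Proof.
apply/quotient_projP; rewrite -scalerBr rpredZ //; apply/quotient_projP.
exact: reprK.
Qed.

Fact quotient_scalerA a b q :
  quotient_scale a (quotient_scale b q) = quotient_scale (a * b) q.
Proof.
by have [x <-] := quotient_proj_surj q; rewrite !quotient_scale_proj scalerA.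
Qed.

Fact quotient_scale1r : left_id 1 quotient_scale.
Proof.
by move=> q; have [x <-] := quotient_proj_surj q;
  rewrite quotient_scale_proj scale1r.
Qed.

Fact quotient_scalerDr : right_distributive quotient_scale +%R.
Proof.
move=> a p q; have [x <-] := quotient_proj_surj p.
have [y <-] := quotient_proj_surj q.
by rewrite -quotient_projD !quotient_scale_proj scalerDr quotient_projD.
Qed.

Fact quotient_scalerDl q : {morph quotient_scale^~ q : a b / a + b}.
Proof.
move=> a b; have [x <-] := quotient_proj_surj q.
by rewrite !quotient_scale_proj scalerDl quotient_projD.
Qed.

HB.instance Definition _ := GRing.Zmodule_isLmodule.Build R quotient_space
  quotient_scalerA quotient_scale1r quotient_scalerDr quotient_scalerDl.

Fact quotient_proj_linear : linear quotient_proj.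
Proof.
by move=> a x y; rewrite quotient_projD; congr +%R; rewrite -quotient_scale_proj.
Qed.

HB.instance Definition _ :=
  GRing.isLinear.Build R X quotient_space _ quotient_proj quotient_proj_linear.

Definition quotient_norm (q : quotient_space) : R :=
  inf [set `|x| | x in [set x : X | quotient_proj x = q]].

Lemma quotient_norm_has_inf q :
  has_inf [set `|x| | x in [set x : X | quotient_proj x = q]].
Proof.
split; first by have [x xq] := quotient_proj_surj q; exists `|x|, x.
by exists 0 => _ [x _ <-].
Qed.

Lemma quotient_norm_ge0 q : 0 <= quotient_norm q.
Proof.
apply: lb_le_inf; first by case: (quotient_norm_has_inf q).
by move=> _ [x _ <-].
Qed.

Lemma quotient_norm_le x : quotient_norm (quotient_proj x) <= `|x|.
Proof.
by apply: ge_inf; [case: (quotient_norm_has_inf (quotient_proj x))|exists x].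
Qed.

Lemma quotient_norm_lt q e : 0 < e ->
  exists x, quotient_proj x = q /\ `|x| < quotient_norm q + e.
Proof.
move=> e0; have [_ [x xq <-] xe] := inf_adherent e0 (quotient_norm_has_inf q).
by exists x.
Qed.

Fact quotient_ler_normD p q :
  quotient_norm (p + q) <= quotient_norm p + quotient_norm q.
Proof.
apply/ler_addgt0Pr => e e0.
have e2 : 0 < e / 2 by rewrite divr_gt0.
have [x [<- xe]] := quotient_norm_lt p e2.
have [y [<- ye]] := quotient_norm_lt q e2.
rewrite -raddfD (le_trans (quotient_norm_le _)) // (le_trans (ler_normD _ _)) //.
by rewrite [e]splitr addrACA lerD // ltW.
Qed.

Fact quotient_normrZ (a : R) q : quotient_norm (a *: q) = `|a| * quotient_norm q.
Proof.
have le b p : quotient_norm (b *: p) <= `|b| * quotient_norm p.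
  apply/ler_addgt0Pr => e e0.
  have b1 : 0 < `|b| + 1 by rewrite ltr_wpDl.
  have [x [<- xe]] := quotient_norm_lt p (divr_gt0 e0 b1).
  rewrite -linearZ (le_trans (quotient_norm_le _)) // normrZ.
  apply: (le_trans (ler_wpM2l (normr_ge0 b) (ltW xe))).
  rewrite mulrDr lerD2l mulrA ler_pdivrMr // mulrC ler_wpM2l ?(ltW e0) //.
  by rewrite lerDl.
apply/eqP; rewrite eq_le le /=.
have [->|a0] := eqVneq a 0; first by rewrite normr0 mul0r quotient_norm_ge0.
rewrite -ler_pdivlMl ?normr_gt0 // -normfV (le_trans _ (le _ _)) //.
by rewrite scalerA mulVf // scale1r.
Qed.

Fact quotient_normr0_eq0 q : quotient_norm q = 0 -> q = 0.
Proof.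
move=> q0; have [x xq] := quotient_proj_surj q.
suff xY : x \in Y by rewrite -xq -(raddf0 quotient_proj);
  apply/quotient_projP; rewrite subr0.
suff : closure [set` subspace_pred Y] x by move/(@subspace_closed _ _ Y).
move=> B /nbhs_ballP[e /= e0 eB].
have [x' [x'q]] := quotient_norm_lt q e0; rewrite q0 add0r => x'e.
exists (x - x'); split; first by apply/quotient_projP; rewrite xq x'q.
by apply: eB; rewrite -ball_normE /ball_ /= opprB addrC subrK.
Qed.

HB.instance Definition _ := Lmodule_isNormed.Build R quotient_space
  quotient_ler_normD quotient_normrZ quotient_normr0_eq0.

End QuotientSpace.

(* Valued in the extended reals so that it is meaningful for unbounded sets. *)
Definition diameter {R : realType} (V : normedModType R) (A : set V) : \bar R :=
  ereal_sup [set `|x.1 - x.2|%:E | x in A `*` A].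

Definition minkowski_comb {R : realType} (V : lmodType R) n (lambda : 'I_n -> R)
    (S : 'I_n -> set V) : set V :=
  [set \sum_(i < n) lambda i *: s i | s in [set s | forall i, S i (s i)]].

Section AverageRough.
Context {R : realType} (Z : normedModType R).

Definition dual_ball : set (dual Z) := [set f | `|f| <= 1].

Definition wslice (z : Z) (alpha : R) : set (dual Z) :=
  [set f | dual_ball f /\ sup [set g z | g in dual_ball] - alpha < f z].

Definition is_wslice (S : set (dual Z)) : Prop :=
  exists (z : Z) (alpha : R), 0 < alpha /\ S = wslice z alpha.

Definition average_rough (e : R) : Prop :=
  forall n (lambda : 'I_n -> R) (S : 'I_n -> set (dual Z)),
    (forall i, 0 < lambda i) -> \sum_(i < n) lambda i = 1 ->
    (forall i, is_wslice (S i)) ->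
    (e%:E <= diameter (minkowski_comb lambda S))%E.

Definition average_non_rough : Prop :=
  forall e : R, 0 < e -> ~ average_rough e.

End AverageRough.

(* Main.v *)
Require Import Defs.
From HB Require Import structures.
From mathcomp Require Import all_boot all_order all_algebra.
From mathcomp Require Import all_classical all_reals all_analysis.
From mathcomp Require Import ring lra.

Set Implicit Arguments.
Unset Strict Implicit.
Unset Printing Implicit Defensive.

Import Order.TTheory GRing.Theory Num.Theory.
Import numFieldNormedType.Exports.

Local Open Scope classical_set_scope.
Local Open Scope ring_scope.

(* We show that if the norm of X is e-average rough then so is the norm of X/Y,
   with constant e/2.

   Given w*-slices S_i = S(q_i, alpha_i) of the ball of (X/Y)^*, pick x_i over q_i
   and f_i in (X/Y)^* norming q_i, seen in the annihilator of Y. The space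
   Z_i = Y + R x_i is reflexive. In a reflexive space Z the points of the dual
   ball are norm limits of convex combinations of elements of w*-slices of
   arbitrarily small diameter. Applied to the restriction of f_i to Z_i, this
   yields a convex combination of w*-slices of the ball of X^* all of whose
   elements nearly agree with f_i on Y and at x_i; hence, by Hahn-Banach, they
   are nearly elements of S_i. Roughness of X then provides two elements of the
   total convex combination that are nearly e apart, and these move to elements
   of the combination of the S_i.

   The density of small slices in reflexive spaces is obtained without separable
   reduction: if all slices at points of some ball were large, one could choose
   nested balls with functionals f_n supporting the norm at their centers so
   that every functional supporting the norm in the n-th ball stays away from
   the first n rational combinations of f_0, ..., f_(n-1). At the common point of
   the balls, a weak-star cluster point of (f_n) supports the norm, yet by
   reflexivity it lies in the norm-closed span of the f_n. *)

(** * Sublinear functionals under a convex family of constraints *)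

Section MazurOrlicz.
Context {R : realType} (V : lmodType R).

Definition sublinear (p : V -> R) : Prop :=
  (forall x y, p (x + y) <= p x + p y) /\
  (forall t x, 0 <= t -> p (t *: x) <= t * p x).

(** A pair [(v, c)] of [A] stands for the constraint [c <= u v] on a linear functional [u]. *)
Definition convex_pairs (A : set (V * R)) : Prop :=
  forall a b t, A a -> A b -> 0 <= t <= 1 ->
    A (t *: a.1 + (1 - t) *: b.1, t * a.2 + (1 - t) * b.2).

Lemma sublinear0 p : sublinear p -> p 0 = 0.
Proof.
move=> [pD pZ]; apply/eqP; rewrite eq_le; apply/andP; split.
  by have := pZ 0 0 (lexx _); rewrite scale0r mul0r.
by have := pD 0 0; rewrite addr0 -{1}(addr0 (p 0)) lerD2l.
Qed.

Lemma sublinear_opp p x : sublinear p -> - p (- x) <= p x.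
Proof.
move=> sp; rewrite -subr_ge0 opprK -(sublinear0 sp) -(subrr x).
exact: (proj1 sp).
Qed.

Lemma sublinearZ p t x : sublinear p -> 0 <= t -> p (t *: x) = t * p x.
Proof.
move=> sp t0; apply/eqP; rewrite eq_le (proj2 sp) //=.
have [->|tn0] := eqVneq t 0; first by rewrite mul0r scale0r sublinear0.
have tp : 0 < t by rewrite lt_neqAle eq_sym tn0.
rewrite -ler_pdivlMl //; have /= := (proj2 sp) t^-1 (t *: x).
by rewrite scalerA mulVf // scale1r; apply; rewrite invr_ge0.
Qed.

Variables (p : V -> R) (A : set (V * R)).
Hypotheses (sp : sublinear p) (A0 : A !=set0) (cA : convex_pairs A).
Hypothesis Ap : forall a, A a -> a.2 <= p a.1.

(** A linear [u <= p] with [a.2 <= u a.1] on [A] satisfies [u h <= p (h + t *: a.1) - t * a.2], so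
    it must lie below the infimum [q] of these values. *)
Let values (h : V) : set R :=
  [set r | exists t a, [/\ 0 <= t, A a & r = p (h + t *: a.1) - t * a.2]].

Let q (h : V) : R := inf (values h).

Let has_inf_values h : has_inf (values h).
Proof.
have [a Aa] := A0; split.
  by exists (p (h + 0 *: a.1) - 0 * a.2), 0, a; split.
exists (- p (- h)) => _ [t [b [t0 Ab ->]]].
rewrite lerBrDr addrC -lerBrDr opprK.
have -> : t * b.2 <= p (h + t *: b.1) + p (- h); last by [].
apply: (@le_trans _ _ (p (t *: b.1))).
  by rewrite sublinearZ // ler_wpM2l // Ap.
by have := (proj1 sp) (h + t *: b.1) (- h); rewrite addrAC subrr add0r.
Qed.

Let q_le h t a : 0 <= t -> A a -> q h <= p (h + t *: a.1) - t * a.2.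
Proof.
by move=> t0 Aa; apply: ge_inf; [case: (has_inf_values h)|exists t, a; split].
Qed.

Let le_q h c :
  (forall t a, 0 <= t -> A a -> c <= p (h + t *: a.1) - t * a.2) -> c <= q h.
Proof.
move=> H; apply: lb_le_inf; first by case: (has_inf_values h).
by move=> _ [t [a [t0 Aa ->]]]; exact: H.
Qed.

Let q_sublinear : sublinear q.
Proof.
split=> [x y|t x t0].
  rewrite -lerBlDr; apply: le_q => s a s0 Aa.
  rewrite lerBlDr -lerBlDl; apply: le_q => t b t0 Ab.
  rewrite lerBlDl.
  (* Convexity of [A] merges [s] times [a] and [t] times [b] into [s + t] times one element of [A];
     this divides by [s + t], hence the separate case. *)
  have [st0|st0] := eqVneq (s + t) 0.
    have [-> ->] : s = 0 /\ t = 0 by split; apply/eqP; rewrite eq_le; lra.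
    rewrite !scale0r !mul0r !subr0 !addr0.
    have := q_le (x + y) (lexx 0) Aa; rewrite scale0r addr0 mul0r subr0.
    by move=> /le_trans; apply; exact: (proj1 sp).
  have stp : 0 < s + t by rewrite lt_neqAle eq_sym st0 addr_ge0.
  have t1 : 0 <= s / (s + t) <= 1.
    by rewrite divr_ge0 ?addr_ge0 //= ler_pdivrMr // mul1r lerDl.
  have := q_le (x + y) (ltW stp) (cA Aa Ab t1).
  have e1 : (s + t) * (s / (s + t)) = s by field.
  have e2 : (s + t) * (1 - s / (s + t)) = t by field.
  rewrite /= scalerDr !scalerA e1 e2 mulrDr.
  rewrite [(s + t) * (_ * a.2)]mulrA [(s + t) * (_ * b.2)]mulrA e1 e2 => /le_trans; apply.
  rewrite [leRHS]addrACA -opprD lerD2r addrACA; exact: (proj1 sp).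
have [a Aa] := A0.
have [->|tn0] := eqVneq t 0.
  have := q_le 0 (lexx 0) Aa.
  by rewrite !scale0r !mul0r addr0 subr0 (sublinear0 sp).
have tp : 0 < t by rewrite lt_neqAle eq_sym tn0.
rewrite -ler_pdivrMl //; apply: le_q => s b s0 Ab.
rewrite ler_pdivrMl // mulrBr -sublinearZ // scalerDr scalerA mulrA.
by apply: q_le => //; rewrite mulr_ge0.
Qed.

(** Taking [t = 0] in the infimum bounds [q] by [p]; taking [t = 1] at [- a.1] gives [p 0 - a.2]. *)
Lemma sublinear_reduction : exists q,
  [/\ sublinear q, forall x, q x <= p x & forall a, A a -> q (- a.1) <= - a.2].
Proof.
exists q; split=> // [x|a Aa].
  have [a Aa] := A0; have := q_le x (lexx 0) Aa.
  by rewrite scale0r addr0 mul0r subr0.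
have := q_le (- a.1) ler01 Aa.
by rewrite scale1r addNr mul1r sublinear0 // sub0r.
Qed.

End MazurOrlicz.

(** * The Hahn-Banach and Mazur-Orlicz theorems *)

Section HahnBanach.
Context {R : realType} {V : lmodType R}.

(** Reducing [p] by the single constraint [(x, p x)] gives a sublinear functional below [p] with
    value at most [- p x] at [- x]. Minimality puts [p] below it, so [p] is odd, and an odd
    sublinear functional is linear. *)
Let minimal_linear (p : V -> R) : sublinear p ->
  (forall q, sublinear q -> (forall x, q x <= p x) -> forall x, p x <= q x) ->
  linear (p : V -> R^o).
Proof.
move=> sp pmin.
have pN x : p (- x) = - p x.
  apply/eqP; rewrite eq_le [X in _ && X]lerNl sublinear_opp // andbT.
  have cA : convex_pairs [set (x, p x)].
    move=> a b t /= -> -> _ /=; rewrite -scalerDl -mulrDl.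
    by rewrite addrC subrK scale1r mul1r.
  have [||q [sq qp qx]] := @sublinear_reduction _ _ p _ sp _ cA.
  - by exists (x, p x).
  - by move=> _ /= ->.
  by rewrite (le_trans (pmin q sq qp _)) //; exact: (qx (x, p x)).
have pD x y : p (x + y) = p x + p y.
  apply/eqP; rewrite eq_le (proj1 sp) /= -lerBrDr -pN.
  by have := (proj1 sp) (x + y) (- y); rewrite addrK.
move=> t x y; rewrite pD; congr (_ + _); rewrite -[t *: p x]/(t * p x).
have [t0|t0] := leP 0 t; first exact: sublinearZ.
by rewrite -[in LHS](opprK t) scaleNr pN sublinearZ ?oppr_ge0 ?ltW // mulNr opprK.
Qed.

(** Zorn's lemma, for the reversed pointwise order [r], yields a minimal sublinear functional below
    [p]; a nonempty chain is bounded by its pointwise infimum. *)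
Lemma hahn_banach_dominated (p : V -> R) : sublinear p ->
  exists u : V -> R^o, linear u /\ forall x, u x <= p x.
Proof.
move=> sp.
pose T := {q : V -> R | sublinear q /\ forall x, q x <= p x}.
pose r (q q' : T) := `[< forall x, sval q' x <= sval q x >].
have t0 : T by exists p.
have [|||m mmin] := @ZL_preorder T t0 r.
- by move=> q; apply/asboolP.
- move=> a b c /asboolP ab /asboolP bc; apply/asboolP => x.
  exact: le_trans (bc x) (ab x).
- move=> A Atot; have [[q0 Aq0]|A0] := pselect (A !=set0); last first.
    by exists t0 => s As; exfalso; apply: A0; exists s.
  pose i x := inf [set sval q x | q in A].
  have lbA x : has_inf [set sval q x | q in A].
    split; first by exists (sval q0 x), q0.
    exists (- p (- x)) => _ [q Aq <-].
    have [sq qp] := svalP q.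
    by rewrite (le_trans _ (sublinear_opp _ sq)) // lerN2.
  have i_le q x : A q -> i x <= sval q x.
    by move=> Aq; apply: ge_inf; [case: (lbA x)|exists q].
  have le_i c x : (forall q, A q -> c <= sval q x) -> c <= i x.
    by move=> H; apply: lb_le_inf; [case: (lbA x)|move=> _ [q Aq <-]; exact: H].
  have si : sublinear i.
    split=> [x y|t x t_ge0].
      rewrite -lerBlDr; apply: (le_i) => a Aa.
      rewrite lerBlDr -lerBlDl; apply: (le_i) => b Ab; rewrite lerBlDl.
      have [/asboolP ab|/asboolP ba] := Atot _ _ Aa Ab.
        rewrite (le_trans (i_le b _ Ab)) //.
        rewrite (le_trans ((proj1 (proj1 (svalP b))) _ _)) //.
        by rewrite lerD.
      rewrite (le_trans (i_le a _ Aa)) //.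
      rewrite (le_trans ((proj1 (proj1 (svalP a))) _ _)) //.
      by rewrite lerD.
    have [->|tn0] := eqVneq t 0.
      rewrite scale0r mul0r (le_trans (i_le q0 _ Aq0)) // sublinear0 //.
      by case: (svalP q0).
    have tp : 0 < t by rewrite lt_neqAle eq_sym tn0.
    rewrite -ler_pdivrMl //; apply: (le_i) => a Aa; rewrite ler_pdivrMl //.
    rewrite (le_trans (i_le a _ Aa)) //.
    by case: (svalP a) => -[_ H] _; exact: H.
  have ip x : i x <= p x.
    by rewrite (le_trans (i_le q0 _ Aq0)) //; case: (svalP q0).
  exists (exist _ i (conj si ip)) => q Aq; apply/asboolP => x /=.
  exact: i_le.
have [sm mp] := svalP m.
exists (sval m); split=> //; apply: minimal_linear => // q sq qm x.
have qp y : q y <= p y by rewrite (le_trans (qm y)).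
have /asboolP : r (exist _ q (conj sq qp)) m by apply: mmin; exact/asboolP.
exact.
Qed.

Lemma mazur_orlicz (p : V -> R) (A : set (V * R)) :
  sublinear p -> A !=set0 -> convex_pairs A -> (forall a, A a -> a.2 <= p a.1) ->
  exists u : V -> R^o,
    [/\ linear u, forall x, u x <= p x & forall a, A a -> a.2 <= u a.1].
Proof.
move=> sp A0 cA Ap; have [q [sq qp qA]] := sublinear_reduction sp A0 cA Ap.
have [u [lu uq]] := hahn_banach_dominated sq.
exists u; split=> // [x|a Aa]; first exact: le_trans (qp x).
pose U : {linear V -> R^o} := HB.pack u (GRing.isLinear.Build R V R^o _ u lu).
have uN : u (- a.1) = - u a.1 by exact: (linearN U).
by rewrite -lerN2 -uN (le_trans (uq _)) // qA.
Qed.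

End HahnBanach.

(** * Separation, norming functionals and extension in normed spaces *)

Section DualSpaceTheory.
Context {R : realType} {Z : normedModType R}.

Lemma dualBE (f g : dual Z) z : (f - g) z = f z - g z. Proof. by []. Qed.

Lemma dualf0 (f : dual Z) : f 0 = 0. Proof. exact: linear0. Qed.

Lemma dualfN (f : dual Z) x : f (- x) = - f x. Proof. exact: linearN. Qed.

Lemma dualfD (f : dual Z) x y : f (x + y) = f x + f y. Proof. exact: linearD. Qed.

Lemma dualfB (f : dual Z) x y : f (x - y) = f x - f y. Proof. exact: linearB. Qed.

Lemma dualfZ (f : dual Z) a x : f (a *: x) = a * f x. Proof. exact: linearZ. Qed.

Lemma dual_bound (f : dual Z) z : `|f z| <= `|f| * `|z|.
Proof. exact: le_dual_norm. Qed.

Lemma dual_unit_bound (f : dual Z) z : `|z| <= 1 -> f z <= `|f|.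
Proof. by move=> z1; apply: le_trans (ler_norm _) (le_dual_norm1 f z1). Qed.

Lemma dual_ball_bound (f : dual Z) z : `|f| <= 1 -> f z <= `|z|.
Proof.
move=> f1; rewrite (le_trans (ler_norm _)) // (le_trans (dual_bound _ _)) //.
by rewrite ler_piMl.
Qed.

Lemma dual_norm_leM (f : dual Z) M :
  0 <= M -> (forall z, f z <= M * `|z|) -> `|f| <= M.
Proof.
move=> M0 fM; apply: dual_norm_le => z z1.
have le y : `|y| <= 1 -> f y <= M by move=> y1; rewrite (le_trans (fM y)) ?ler_piMr.
by rewrite ler_norml le // andbT lerNl -dualfN le ?normrN.
Qed.

Lemma dual_of_bounded (u : Z -> R^o) M : 0 <= M -> linear u ->
  (forall z, u z <= M * `|z|) ->
  exists f : dual Z, `|f| <= M /\ forall z, f z = u z.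
Proof.
move=> M0 lu uM.
pose U : {linear Z -> R^o} := HB.pack u (GRing.isLinear.Build R Z R^o _ u lu).
have cu : continuous u.
  apply: (@bounded_linear_continuous _ _ _ U); apply/linear_boundedP.
  near=> r => x; rewrite (@le_trans _ _ (M * `|x|)) //.
    rewrite -[U x]/(u x) ler_norml uM andbT lerNl -[u x]/(U x) -linearN.
    by rewrite -(normrN x) uM.
  by rewrite ler_wpM2r //; near: r; exact: nbhs_pinfty_ge.
have du : is_dual u by apply/asboolP.
by exists (Dual du); split=> //; exact: dual_norm_leM.
Unshelve. all: by end_near. Qed.

Lemma sublinear_norm (M : R) : 0 <= M -> sublinear (fun z : Z => M * `|z|).
Proof.
move=> M0; split=> [x y|t x t0]; first by rewrite -mulrDr ler_wpM2l ?ler_normD.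
by rewrite normrZ ger0_norm // mulrCA.
Qed.

(** Mazur-Orlicz for the norm, under the constraints [eta <= u (z - k)] for [k] in [K]. *)
Lemma separation (K : set Z) (z : Z) (eta : R) : K !=set0 ->
  (forall a b t, K a -> K b -> 0 <= t <= 1 -> K (t *: a + (1 - t) *: b)) ->
  (forall k, K k -> eta <= `|z - k|) ->
  exists f : dual Z, `|f| <= 1 /\ forall k, K k -> f k + eta <= f z.
Proof.
move=> [k0 Kk0] cK Kz.
pose A := [set (z - k, eta) | k in K].
have [||_ _ t [k Kk <-] [l Kl <-] t01|_ [k Kk <-]|u [lu up uA]] :=
    @mazur_orlicz R Z (fun z => 1 * `|z|) A.
- exact: sublinear_norm.
- by exists (z - k0, eta), k0.
- exists (t *: k + (1 - t) *: l); first exact: cK.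
  congr pair => /=; last by rewrite -mulrDl addrC subrK mul1r.
  rewrite !scalerBr addrACA -scalerDl [t + _]addrC subrK scale1r.
  by rewrite -opprD.
- by rewrite mul1r; exact: Kz.
have [f [f1 fu]] := dual_of_bounded ler01 lu up.
exists f; split=> // k Kk; rewrite addrC -lerBrDr -dualfB fu.
by apply: (uA (z - k, eta)); exists k.
Qed.

Lemma norming_functional (z : Z) : exists f : dual Z, `|f| <= 1 /\ f z = `|z|.
Proof.
have [||k ->|f [f1 fz]] := @separation [set 0] z `|z|.
- by exists 0.
- by move=> a b t -> -> _ /=; rewrite !scaler0 addr0.
- by rewrite subr0.
exists f; split=> //; apply/eqP; rewrite eq_le dual_ball_bound //=.
by have := fz 0 erefl; rewrite dualf0 add0r.
Qed.

Lemma norm_le_dual_ball (z : Z) (M : R) :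
  (forall f : dual Z, `|f| <= 1 -> f z <= M) -> `|z| <= M.
Proof. by move=> fM; have [f [f1 <-]] := norming_functional z; exact: fM. Qed.

Lemma sup_dual_ball (z : Z) : sup [set g z | g in dual_ball (Z := Z)] = `|z|.
Proof.
have [f [f1 fz]] := norming_functional z.
have ub : ubound [set g z | g in dual_ball (Z := Z)] `|z|.
  by move=> _ [g g1 <-]; exact: dual_ball_bound.
apply/eqP; rewrite eq_le ge_sup //=; last by exists (f z), f.
apply: ub_le_sup; first by exists `|z|.
by exists f.
Qed.

Lemma wsliceP (z : Z) alpha (f : dual Z) :
  wslice z alpha f <-> `|f| <= 1 /\ `|z| - alpha < f z.
Proof. by rewrite /wslice /= sup_dual_ball. Qed.

Lemma norm_gtP (f : dual Z) (c : R) : 0 <= c -> c < `|f| ->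
  exists e, `|e| <= 1 /\ c < f e.
Proof.
move=> c0 cf; apply: contrapT => fe.
have le e : `|e| <= 1 -> f e <= c.
  by move=> e1; rewrite leNgt; apply/negP => ce; apply: fe; exists e.
suff : `|f| <= c by rewrite leNgt cf.
apply: dual_norm_le => z z1.
by rewrite ler_norml le // andbT lerNl -dualfN le ?normrN.
Qed.

End DualSpaceTheory.

(** The constraints are the graph of [g]; the inequality they give, taken at [y] and [- y], is an
    equality. *)
Lemma dual_extension {R : realType} {X : normedModType R} (Y : closedSubspace X)
    (g : dual (subspace_of Y)) :
  exists u : dual X, `|u| <= `|g| /\ forall y : subspace_of Y, u (val y) = g y.
Proof.
pose A := [set (val y, g y) | y in [set: subspace_of Y]].
have [||_ _ t [x _ <-] [y _ <-] _|_ [y _ <-]|u [lu up uA]] :=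
    @mazur_orlicz R X (fun x => `|g| * `|x|) A.
- exact: sublinear_norm.
- by exists (val (0 : subspace_of Y), g 0), 0.
- exists (t *: x + (1 - t) *: y) => //=.
  by rewrite !linearD /= !linearZ.
- by rewrite (le_trans (ler_norm _)) //= (dual_bound g y).
have [f [fg fu]] := dual_of_bounded (normr_ge0 g) lu up.
exists f; split=> // y.
have le x : g x <= f (val x) by rewrite fu; apply: (uA (val x, g x)); exists x.
apply/eqP; rewrite eq_le le andbT -lerN2 -!dualfN -raddfN; exact: le.
Qed.

(** * Weak-star limits along ultrafilters, and nested balls *)

Section WeakStarCluster.
Context {R : realType} {Z : normedModType R}.

Lemma ultrafilter_cvg (U : set_system nat) (u : nat -> R) (a b : R) :
  UltraFilter U -> (forall n, a <= u n <= b) -> exists l : R, u n @[n --> U] --> l.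
Proof.
move=> UU uab.
have Uab : U (u @^-1` [set` `[a, b]]).
  by apply: filterE => n /=; rewrite in_itv /=; exact: uab.
have [l [_ cl]] := @segment_compact R a b (u @ U) _ Uab.
exists l => B lB.
have [//|nB] := in_ultra_setVsetC (u @^-1` B) UU.
by have [x [nBx Bx]] := cl _ _ (nB : (u @ U) (~` B)) lB.
Qed.

(** A form of Banach-Alaoglu for sequences: one ultrafilter gives the limits at all points at once,
    and linearity and the bound pass to the limit. *)
Lemma dual_ultrafilter_cvg (U : set_system nat) (f : nat -> dual Z) (M : R) :
  UltraFilter U -> 0 <= M -> (forall n, `|f n| <= M) ->
  exists g : dual Z, `|g| <= M /\ forall z, f n z @[n --> U] --> g z.
Proof.
move=> UU M0 fM.
have bd n z : `|f n z| <= M * `|z|.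
  by rewrite (le_trans (dual_bound _ _)) // ler_wpM2r.
have /choice[u uP] z : exists l : R, f n z @[n --> U] --> l.
  by apply: (@ultrafilter_cvg U (f^~ z) (- (M * `|z|)) (M * `|z|)) => n; rewrite -ler_norml.
have lu : linear (u : Z -> R^o).
  move=> a x y.
  have e n : f n (a *: x + y) = a * f n x + f n y by rewrite linearP.
  have := uP (a *: x + y); under eq_fun do rewrite e.
  move=> uaxy; apply: (@cvg_unique _ (@norm_hausdorff _ R) _ _ _ _ uaxy).
  by apply: cvgD => //; apply: cvgMr.
have uM z : u z <= M * `|z|.
  apply: (ler_cvg_to (uP z) (cvg_cst (M * `|z|))).
  by apply: filterE => n /=; rewrite (le_trans (ler_norm _)).
have [g [gM gu]] := dual_of_bounded M0 lu uM.
by exists g; split=> // z; rewrite gu.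
Qed.

End WeakStarCluster.

(** The centers, as evaluations in the bidual, have a weak-star limit, which reflexivity represents
    by a point [x]. The bound [rho n] holds for all later centers and passes to the limit on every
    functional of the ball. *)
Lemma reflexive_nested_balls {R : realType} (Z : normedModType R)
    (z : nat -> Z) (rho : nat -> R) : reflexive_space Z ->
  (forall n m, (n <= m)%N -> `|z m - z n| <= rho n) ->
  exists x, forall n, `|x - z n| <= rho n.
Proof.
move=> Zr zrho.
have [U [UU Uoo]] := ultraFilterLemma (eventually_filter : ProperFilter \oo).
pose M := `|z 0%N| + rho 0%N.
have M0 : 0 <= M.
  by rewrite addr_ge0 // (le_trans _ (zrho _ _ (leqnn 0))).
have zM n : `|z n| <= M.
  rewrite -[z n](subrK (z 0%N)) addrC (le_trans (ler_normD _ _)) // lerD2l.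
  exact: zrho.
have /choice[ev evP] n : exists F : dual (dual Z), `|F| <= M /\ forall f, F f = f (z n).
  apply: (@dual_of_bounded _ _ (fun f : dual Z => f (z n)) M M0).
    by move=> a f g; rewrite dualDE dualZE.
  move=> f; rewrite (le_trans (ler_norm _)) // (le_trans (dual_bound _ _)) //.
  by rewrite mulrC ler_wpM2r.
have [F [_ Fcvg]] := dual_ultrafilter_cvg UU M0 (fun n => proj1 (evP n)).
have [x Fx] := Zr F; exists x => n; apply: norm_le_dual_ball => f f1.
rewrite dualfB lerBlDr -Fx.
apply: (ler_cvg_to (Fcvg f) (cvg_cst (rho n + f (z n)))).
apply: Uoo; exists n => // m /= nm; rewrite (proj2 (evP m)) -lerBlDr -dualfB.
by rewrite (le_trans (dual_ball_bound _ f1)) // zrho.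
Qed.

(** * Balls on which supporting functionals avoid given ones *)

Section SmallSlices.
Context {R : realType} {Z : normedModType R}.

Definition slices_large (delta : R) (z : Z) : Prop := forall alpha, 0 < alpha ->
  exists g h : dual Z,
    [/\ wslice z alpha g, wslice z alpha h & delta < `|g - h|].

(** The functionals [g] are the subgradients of the norm at [w]. *)
Definition supports_avoid (delta : R) (d : dual Z) (z : Z) (rho : R) : Prop :=
  forall w (g : dual Z), `|w - z| <= rho -> `|g| <= 1 -> g w = `|w| ->
    delta <= `|g - d|.

Lemma supports_avoid_sub delta d z rho z' rho' :
  `|z' - z| + rho' <= rho -> supports_avoid delta d z rho ->
  supports_avoid delta d z' rho'.
Proof.
move=> sub av w g wz'; apply: av.
rewrite -[w - z](subrKA z') (le_trans (ler_normD _ _)) //.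
by rewrite addrC (le_trans _ sub) // lerD2l.
Qed.

(** Here [D = t * delta], and [A], [B], [C] are [t] times the values of [f'], [g], [d] at [e]. The
    hypotheses chain to [B >= A - a - 2 * r >= A - 3 * a]. *)
Let avoid_one_arith (D a r fz A B C gz gze fze nz nze nw : R) :
  0 < D -> a = D / 16 -> r <= a -> nz - a < fz -> gze = gz + B ->
  fze = fz + A -> gz <= nz -> fze <= nze -> nw - gze <= r -> nze <= r + nw ->
  D / 2 < A - C -> D / 4 <= B - C.
Proof. lra. Qed.

(* Some f' in a slice at z is at distance > delta / 2 from d, witnessed by a unit
   direction e; monotonicity of subgradients transfers this to all functionals
   supporting a point near z + t e. *)
Lemma avoid_one delta z rho d : 0 < delta -> 0 < rho -> slices_large delta z ->
  exists z' rho', [/\ 0 < rho', `|z' - z| + rho' <= rho &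
    supports_avoid (delta / 4) d z' rho'].
Proof.
move=> delta0 rho0 zl.
(* A ball of radius at most [t] about [z + t *: e] stays in the given one; the slice width [a] lets
   three errors fit between [delta / 2] and [delta / 4]. *)
pose t := rho / 2; have t0 : 0 < t by rewrite divr_gt0.
pose a := t * delta / 16; have a0 : 0 < a by rewrite divr_gt0 ?mulr_gt0.
have [f' [/wsliceP[f'1 f'z] f'd]] :
    exists f' : dual Z, wslice z a f' /\ delta / 2 < `|f' - d|.
  have [g [h [gz hz gh]]] := zl _ a0.
  have half (x y w : R) : delta < w -> w <= x + y -> delta / 2 < x \/ delta / 2 < y.
    by move=> dw wxy; have [|] := ltrP (delta / 2) x; [left|right; lra].
  have [gd|hd] := half _ _ _ gh (ler_distD d g h).
    exact: ex_intro _ g (conj gz gd).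
  rewrite distrC in hd; exact: ex_intro _ h (conj hz hd).
have [||e [e1 ed]] := @norm_gtP _ _ (f' - d) (delta / 2) => //.
  by rewrite divr_ge0 // ltW.
pose rho' := Num.min t a.
have rho't : rho' <= t by rewrite ge_min lexx.
have rho'a : rho' <= a by rewrite ge_min lexx orbT.
exists (z + t *: e), rho'; split.
- by rewrite lt_min t0.
- rewrite [z + _ - z]addrAC subrr add0r normrZ gtr0_norm //.
  have : t * `|e| <= t by rewrite ler_piMr // ltW.
  by rewrite /t in rho't *; lra.
move=> w g wz g1 gw.
apply: le_trans _ (dual_unit_bound (g - d) e1).
have dE (k : dual Z) : (k - d) e = k e - d e by [].
have h1 : g (z + t *: e) = g z + t * g e by rewrite dualfD dualfZ.
have h2 : f' (z + t *: e) = f' z + t * f' e by rewrite dualfD dualfZ.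
have h3 : g z <= `|z| by exact: dual_ball_bound.
have h4 : f' (z + t *: e) <= `|z + t *: e| by exact: dual_ball_bound.
have h5 : g (w - (z + t *: e)) <= rho'.
  exact: le_trans (dual_ball_bound _ g1) wz.
have h6 : `|z + t *: e| <= rho' + `|w|.
  rewrite -[z + t *: e](subrK w) (le_trans (ler_normD _ _)) // lerD2r.
  by rewrite distrC.
rewrite dualfB gw in h5; rewrite dE in ed *.
rewrite -(ler_pM2l t0) mulrBr mulrA.
rewrite -(ltr_pM2l t0) mulrBr mulrA in ed.
have D0 : 0 < t * delta by rewrite mulr_gt0.
exact: (avoid_one_arith D0 erefl rho'a f'z h1 h2 h3 h4 h5 h6 ed).
Qed.

(** The members of [ds] are avoided one after another; shrinking the ball keeps what was avoided
    before. *)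
Lemma avoid_seq delta z0 r (ds : seq (dual Z)) z rho e :
  (forall z, `|z - z0| < r -> slices_large delta z) ->
  0 < delta -> 0 < rho -> 0 < e -> `|z - z0| + rho <= r ->
  exists z' rho', [/\ 0 < rho', rho' <= e, `|z' - z| + rho' <= rho &
    forall d, d \in ds -> supports_avoid (delta / 4) d z' rho'].
Proof.
move=> zl delta0 rho0 e0 zr; elim: ds => [|d ds [z1 [r1 [r10 r1e zr1 dsP]]]].
  exists z, (Num.min rho e); split=> //; first by rewrite lt_min rho0.
    by rewrite ge_min lexx orbT.
  by rewrite subrr normr0 add0r ge_min lexx.
have z1z0 : `|z1 - z0| <= `|z1 - z| + `|z - z0|.
  by rewrite -[z1 - z0](subrKA z) ler_normD.
have [|z2 [r2 [r20 zr2 dP]]] := @avoid_one delta z1 r1 d delta0 r10.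
  by apply: zl; lra.
have z2z : `|z2 - z| <= `|z2 - z1| + `|z1 - z|.
  by rewrite -[z2 - z](subrKA z1) ler_normD.
exists z2, r2; split=> // [||d'].
- by have := normr_ge0 (z2 - z1); lra.
- by lra.
rewrite inE => /orP[/eqP -> //|d'ds].
exact: supports_avoid_sub zr2 (dsP _ d'ds).
Qed.

(** The coefficients form a [seq rat], a countable type, so that [pickle] numbers all
    combinations. *)
Definition rat_comb (q : seq rat) (s : seq (dual Z)) : dual Z :=
  \sum_(i < size q) (ratr q`_i : R) *: s`_i.

Lemma avoiding_sequence delta z0 r :
  (forall z, `|z - z0| < r -> slices_large delta z) -> 0 < delta -> 0 < r ->
  exists (z : nat -> Z) (rho : nat -> R) (f : nat -> dual Z),
  [/\ forall n, `|f n| <= 1 /\ f n (z n) = `|z n|,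
      forall n, rho n.+1 <= n.+1%:R^-1,
      forall n m, (n <= m)%N -> `|z m - z n| <= rho n &
      forall q n, (pickle q < n)%N -> (size q <= n)%N ->
        supports_avoid (delta / 4) (rat_comb q (mkseq f n)) (z n.+1) (rho n.+1)].
Proof.
move=> zl delta0 r0.
have /choice[S SP] := @norming_functional R Z.
have /choice[nx nxP] (a : Z * R * seq (dual Z) * R) : exists b : Z * R,
    0 < a.1.1.2 -> 0 < a.2 -> `|a.1.1.1 - z0| + a.1.1.2 <= r ->
    [/\ 0 < b.2, b.2 <= a.2, `|b.1 - a.1.1.1| + b.2 <= a.1.1.2 &
      forall d, d \in a.1.2 -> supports_avoid (delta / 4) d b.1 b.2].
  case: a => [[[z rho] ds] e] /=.
  have [rho0|rho0] := leP rho 0; first by exists (z, rho).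
  have [e0|e0] := leP e 0; first by exists (z, rho).
  have [zr|zr] := leP (`|z - z0| + rho) r; last by exists (z, rho).
  have [z' [rho' H]] := avoid_seq ds zl delta0 rho0 e0 zr.
  by exists (z', rho').
(* Stage [n] has to avoid the combinations whose code is below [n]. The state [st n] holds a center,
   a radius and the functionals norming the earlier centers. *)
pose tasks (n : nat) (s : seq (dual Z)) :=
  [seq rat_comb q s | q <- pmap (@unpickle (seq rat)) (iota 0 n)].
pose st := fix st n : Z * R * seq (dual Z) := if n is m.+1 then
    (nx (((st m).1, tasks m (st m).2), m.+1%:R^-1), rcons (st m).2 (S (st m).1.1))
  else ((z0, r), [::]).
pose z n := (st n).1.1; pose rho n := (st n).1.2.
have stS n : (st n).2 = mkseq (fun i => S (z i)) n.
  by elim: n => // n IH /=; rewrite IH mkseqS.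
have e0 n : 0 < n.+1%:R^-1 :> R by rewrite invr_gt0.
have inv n : 0 < rho n /\ `|z n - z0| + rho n <= r.
  elim: n => [|n [rn zn]]; first by rewrite /rho /z /= subrr normr0 add0r.
  have [r' _ zr' _] := nxP (((st n).1, tasks n (st n).2), n.+1%:R^-1) rn (e0 n) zn.
  split; first exact: r'.
  have : `|z n.+1 - z0| <= `|z n.+1 - z n| + `|z n - z0|.
    by rewrite -[_ - z0](subrKA (z n)) ler_normD.
  by move: zr'; rewrite /= -/(z n.+1) -/(rho n.+1); lra.
have step n : [/\ rho n.+1 <= n.+1%:R^-1, `|z n.+1 - z n| + rho n.+1 <= rho n &
    forall d, d \in tasks n (st n).2 ->
      supports_avoid (delta / 4) d (z n.+1) (rho n.+1)].
  have [rn zn] := inv n.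
  by have [] := nxP (((st n).1, tasks n (st n).2), n.+1%:R^-1) rn (e0 n) zn.
exists z, rho, (fun n => S (z n)); split=> [n|n|n m|q n qn sn].
- exact: SP.
- by case: (step n).
- move=> /subnKC <-; move: (m - n)%N => k.
  suff : `|z (n + k)%N - z n| + rho (n + k)%N <= rho n.
    by have [] := inv (n + k)%N; lra.
  elim: k => [|j IH]; first by rewrite addn0 subrr normr0 add0r.
  have [_ zj _] := step (n + j)%N; rewrite addnS.
  have : `|z (n + j).+1 - z n| <= `|z (n + j).+1 - z (n + j)%N| + `|z (n + j)%N - z n|.
    by rewrite -[_ - z n](subrKA (z (n + j)%N)) ler_normD.
  by lra.
have [_ _] := step n; apply; rewrite -stS; apply: map_f.
by rewrite mem_pmap; apply/mapP; exists (pickle q); rewrite ?mem_iota ?pickleK.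
Qed.

End SmallSlices.

(** * Small slices and their convex combinations in reflexive spaces *)

Section ReflexiveSlices.
Context {R : realType} {Z : normedModType R}.

Definition lin_span (f : nat -> dual Z) : set (dual Z) :=
  [set l | exists (N : nat) (c : nat -> R), l = \sum_(i < N) c i *: f i].

Lemma lin_spanE (f : nat -> dual Z) (N M : nat) (c : nat -> R) : (N <= M)%N ->
  \sum_(i < N) c i *: f i = \sum_(i < M) (if (i < N)%N then c i else 0) *: f i.
Proof.
move=> NM; rewrite (big_ord_widen M (fun i => c i *: f i) NM) big_mkcond /=.
by apply: eq_bigr => i _; case: ifP => // _; rewrite scale0r.
Qed.

Lemma lin_span_convex (f : nat -> dual Z) a b t :
  lin_span f a -> lin_span f b -> lin_span f (t *: a + (1 - t) *: b).
Proof.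
move=> [N [c ->]] [M [d ->]].
exists (maxn N M), (fun i => t * (if (i < N)%N then c i else 0)
  + (1 - t) * (if (i < M)%N then d i else 0)).
rewrite (lin_spanE f c (leq_maxl N M)) (lin_spanE f d (leq_maxr N M)).
rewrite !scaler_sumr -big_split /=; apply: eq_bigr => i _.
by rewrite !scalerA -scalerDl.
Qed.

Lemma lin_span_line (f : nat -> dual Z) n c : lin_span f (c *: f n).
Proof.
exists n.+1, (fun i => if i == n then c else 0).
rewrite big_ord_recr /= eqxx big1 ?add0r // => i _.
by rewrite ltn_eqF ?scale0r.
Qed.

(** Each coefficient is rounded to a close rational. Once [n] reaches [size q], the prefix of [f]
    contains all functionals used, so one [q] serves every such [n]. *)
Lemma rat_comb_dense (f : nat -> dual Z) (l : dual Z) (eta : R) :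
  (forall n, `|f n| <= 1) -> lin_span f l -> 0 < eta ->
  exists q : seq rat, forall n, (size q <= n)%N ->
    `|l - rat_comb q (mkseq f n)| <= eta.
Proof.
move=> f1 [N [c ->]] eta0.
have [e [e0 eN]] : exists e, 0 < e /\ e * N%:R <= eta.
  exists (eta / N.+1%:R); rewrite divr_gt0 // -mulrA ler_piMr ?(ltW eta0) //.
  by rewrite mulrC ler_pdivrMr // mul1r ler_nat.
have /choice[Q QP] i : exists q : rat, `|c i - ratr q| <= e.
  have [|q] := @rat_in_itvoo R (c i - e) (c i + e).
    by lra.
  rewrite in_itv /= => /andP[q1 q2]; exists q.
  by rewrite ler_norml; apply/andP; split; lra.
exists (mkseq Q N) => n; rewrite size_mkseq => Nn.
rewrite /rat_comb size_mkseq -sumrB.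
apply: (@le_trans _ _ (\sum_(i < N) e)).
  apply: (le_trans (ler_norm_sum _ _ _)); apply: ler_sum => i _.
  rewrite !nth_mkseq ?(leq_trans _ Nn) // -scalerBl normrZ.
  by apply: le_trans (QP i); rewrite ler_piMr.
by rewrite sumr_const card_ord -mulr_natr.
Qed.

(* Otherwise the functionals supporting the norm along a suitable convergent
   sequence would have a weak-star cluster point far from their linear span,
   which reflexivity forbids. *)
Lemma small_slices_dense (z0 : Z) (delta r : R) :
  reflexive_space Z -> 0 < delta -> 0 < r ->
  exists z alpha, [/\ `|z - z0| < r, 0 < alpha &
    forall g h, wslice z alpha g -> wslice z alpha h -> `|g - h| <= delta].
Proof.
move=> Zr delta0 r0; apply: contrapT => small.
have large z : `|z - z0| < r -> slices_large delta z.
  move=> zr alpha alpha0; apply: contrapT => gh; apply: small.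
  exists z, alpha; split=> // g h gz hz; rewrite leNgt; apply/negP => dgh.
  by apply: gh; exists g, h; split.
have [z [rho [f [fP rhoS zrho avoid]]]] := avoiding_sequence large delta0 r0.
have f1 n : `|f n| <= 1 by case: (fP n).
have [x xP] := reflexive_nested_balls Zr zrho.
have [U [UU Uoo]] := ultraFilterLemma (eventually_filter : ProperFilter \oo).
have [g [g1 fg]] := dual_ultrafilter_cvg UU ler01 f1.
(* Each [f n] norms its center and the centers converge to [x], so the weak-star limit [g] norms
   [x]. *)
have gx : g x = `|x|.
  apply/eqP; rewrite eq_le dual_ball_bound //=.
  apply/ler_addgt0Pr => e e0; rewrite -lerBlDr.
  apply: (ler_cvg_to (cvg_cst (`|x| - e)) (fg x)); apply: Uoo.
  have e2 : 0 < e / 2 by rewrite divr_gt0.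
  have [N _ Ne] := near_infty_natSinv_lt (PosNum e2).
  exists N.+1 => // -[//|n] /= Nn.
  have h1 : `|x - z n.+1| <= e / 2.
    by apply: le_trans (xP _) (le_trans (rhoS n) (ltW _)); exact: (Ne n Nn).
  have h2 : f n.+1 (z n.+1 - x) <= `|x - z n.+1|.
    by rewrite distrC dual_ball_bound.
  have h3 : `|x| <= `|x - z n.+1| + `|z n.+1|.
    by rewrite -{1}[x](subrK (z n.+1)) ler_normD.
  rewrite dualfB (proj2 (fP n.+1)) in h2.
  by lra.
have arith (a b c : R) : delta / 4 <= a -> a <= b + c -> c <= delta / 8 ->
    delta / 8 <= b by clear; lra.
have far l : lin_span f l -> delta / 8 <= `|g - l|.
  move=> lf; have d8 : 0 < delta / 8 by rewrite divr_gt0.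
  have [q qP] := rat_comb_dense f1 lf d8.
  (* By this stage [q] has been treated and all functionals that it uses are in the list. *)
  pose n := maxn (pickle q).+1 (size q).
  have qn : (pickle q < n)%N by rewrite leq_maxl.
  have sn : (size q <= n)%N by rewrite leq_maxr.
  have h1 := avoid q n qn sn x g (xP _) g1 gx.
  have h2 := ler_distD l g (rat_comb q (mkseq f n)).
  have h3 := qP n sn.
  exact: arith h1 h2 h3.
have span0 : lin_span f 0 by exists 0%N, (fun=> 0); rewrite big_ord0.
have [|a b t af bf _|F [_ FP]] := separation _ _ far.
- by exists 0.
- exact: lin_span_convex.
have [y Fy] := Zr F.
(* [F] is bounded above on the span, so [y] annihilates each [f n]: otherwise the multiple of [f n]
   by [g y / f n y] would reach the value [g y]. Then [g y], a limit of zeros, contradicts the gap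
   at the origin. *)
have fy n : f n y = 0.
  apply/eqP/negP => /negP fny.
  have := FP _ (lin_span_line f n (g y / f n y)).
  rewrite !Fy dualZE divfK // => h.
  by lra.
have gy : g y = 0.
  have := fg y; under eq_fun do rewrite fy.
  move=> /(@cvg_unique _ (@norm_hausdorff _ R) _ _ _ _ (cvg_cst _)) <- //.
have := FP _ span0; rewrite !Fy gy => h.
have : (0 : dual Z) y = 0 by [].
by lra.
Qed.

(** Arbitrary finite index types, instead of ordinals, let two combinations be merged over the
    disjoint union of their indices. *)
Definition small_slice_comb (delta : R) : set (dual Z) :=
  [set k | exists (I : finType) (mu : I -> R) (S : I -> set (dual Z))
      (h : I -> dual Z),
    [/\ forall i, 0 < mu i, \sum_i mu i = 1, forall i, is_wslice (S i),
        forall i, S i (h i) /\ (forall g, S i g -> `|g - h i| <= delta) &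
        k = \sum_i mu i *: h i]].

Lemma small_slice_comb_convex delta a b t :
  small_slice_comb delta a -> small_slice_comb delta b -> 0 <= t <= 1 ->
  small_slice_comb delta (t *: a + (1 - t) *: b).
Proof.
move=> Ka Kb /andP[t0 t1].
(* The endpoints are set apart because weights must be positive. *)
have [->|tn0] := eqVneq t 0; first by rewrite scale0r add0r subr0 scale1r.
have [->|tn1] := eqVneq t 1; first by rewrite subrr scale0r addr0 scale1r.
have tp : 0 < t by rewrite lt_neqAle eq_sym tn0.
have tp' : 0 < 1 - t by rewrite subr_gt0 lt_neqAle tn1.
move: Ka Kb => [I [mu [S [h [mu0 mu1 Sw Sh ->]]]]] [J [nu [T [k [nu0 nu1 Tw Tk ->]]]]].
exists (I + J)%type,
  (fun x => match x with inl i => t * mu i | inr j => (1 - t) * nu j end),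
  (fun x => match x with inl i => S i | inr j => T j end),
  (fun x => match x with inl i => h i | inr j => k j end); split.
- by case=> x; rewrite mulr_gt0.
- by rewrite big_sumType /= -!mulr_sumr mu1 nu1 !mulr1 addrC subrK.
- by case.
- by case.
- rewrite big_sumType /= !scaler_sumr.
  by congr (_ + _); apply: eq_bigr => i _; rewrite scalerA.
Qed.

(** Otherwise a functional separates [f] from the combinations, and reflexivity represents it by a
    point [y]. A small slice at some [z] near [y] contains a [k] that almost norms [y], which leaves
    no room for a gap of [delta] between [k y] and [f y]. *)
Lemma small_slice_comb_dense (f : dual Z) (delta : R) :
  reflexive_space Z -> 0 < delta -> `|f| <= 1 ->
  exists2 k, small_slice_comb delta k & `|f - k| < delta.
Proof.
move=> Zr delta0 f1; apply: contrapT => near.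
have far k : small_slice_comb delta k -> delta <= `|f - k|.
  by move=> Kk; rewrite leNgt; apply/negP => fk; apply: near; exists k.
have single z alpha k : 0 < alpha -> wslice z alpha k ->
    (forall g h, wslice z alpha g -> wslice z alpha h -> `|g - h| <= delta) ->
    small_slice_comb delta k.
  move=> alpha0 zk zs; exists unit, (fun=> 1), (fun=> wslice z alpha), (fun=> k).
  split=> //.
  - by rewrite big_const card_unit /= addr0.
  - by move=> _; exists z, alpha.
  - by move=> _; split=> // g zg; exact: zs.
  - by rewrite big_const card_unit /= addr0 scale1r.
have wslice_nonempty z alpha : 0 < alpha -> exists k : dual Z, wslice z alpha k.
  move=> alpha0; have [k [k1 kz]] := norming_functional z.
  by exists k; apply/wsliceP; split=> //; rewrite kz ltrBlDr ltrDl.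
have [|a b t|F [_ FP]] := separation _ _ far.
- have [z [alpha [_ alpha0 zs]]] := small_slices_dense 0 Zr delta0 ltr01.
  have [k zk] := wslice_nonempty z _ alpha0.
  by exists k; exact: single zk zs.
- exact: small_slice_comb_convex.
have [y Fy] := Zr F.
have delta8 : 0 < delta / 8 by rewrite divr_gt0.
have [z [alpha [zy alpha0 zs]]] := small_slices_dense y Zr delta0 delta8.
(* Narrowing the slice keeps it small and makes its elements norm [z] up to [delta / 8]. *)
pose beta := Num.min alpha (delta / 8).
have [k zk] : exists k : dual Z, wslice z beta k.
  by apply: wslice_nonempty; rewrite lt_min alpha0.
have wz g : wslice z beta g -> wslice z alpha g.
  move=> /wsliceP[g1 gz]; apply/wsliceP; split=> //; apply: le_lt_trans gz.
  by rewrite lerD2l lerN2 ge_min lexx.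
have {}zs g h : wslice z beta g -> wslice z beta h -> `|g - h| <= delta.
  by move=> gz hz; apply: zs; exact: wz.
have beta0 : 0 < beta by rewrite lt_min alpha0.
have := FP _ (single _ _ _ beta0 zk zs); rewrite !Fy.
have betad : beta <= delta / 8 by rewrite ge_min lexx orbT.
have /wsliceP[k1 kz] := zk.
have h1 : f y <= `|y| by exact: dual_ball_bound.
have h2 : `|y| <= `|z - y| + `|z|.
  by rewrite distrC -{1}[y](subrK z) ler_normD.
have h3 : k (z - y) <= `|z - y| by exact: dual_ball_bound.
rewrite dualfB in h3.
have arith (b u v fy l ky c : R) : u - b < l -> b <= delta / 8 -> fy <= v ->
    v <= c + u -> l - ky <= c -> c < delta / 8 -> ky + delta <= fy -> False.
  by clear - delta0; lra.
exact: arith kz betad h1 h2 h3 zy.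
Qed.

End ReflexiveSlices.

(** * Functionals on a subspace, on its quotient and on the whole space *)

Section SubspaceDuality.
Context {R : realType} {X : normedModType R}.

Lemma subspace_valP (Y : closedSubspace X) a (u v : subspace_of Y) :
  val (a *: u + v) = a *: val u + val v.
Proof. exact: linearP. Qed.

Lemma subspace_ext (Y : closedSubspace X) (u v : subspace_of Y) :
  val u = val v -> u = v.
Proof. exact: val_inj. Qed.

Lemma dual_restriction (Y : closedSubspace X) (g : dual X) :
  exists r : dual (subspace_of Y), `|r| <= `|g| /\ forall y, r y = g (val y).
Proof.
apply: (@dual_of_bounded _ (subspace_of Y) (fun y => g (val y)) `|g|) => //.
  by move=> a y z; rewrite subspace_valP dualfD dualfZ.
by move=> y; rewrite (le_trans (ler_norm _)) // (dual_bound g (val y)).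
Qed.

Lemma dual_pullback (Y : closedSubspace X) (g : dual (quotient_space Y)) :
  exists G : dual X, `|G| <= `|g| /\ forall x, G x = g (quotient_proj Y x).
Proof.
apply: (@dual_of_bounded _ X (fun x => g (quotient_proj Y x)) `|g|) => //.
  by move=> a x y; rewrite linearP dualfD dualfZ.
move=> x; rewrite (le_trans (ler_norm _)) // (le_trans (dual_bound g _)) //.
by rewrite ler_wpM2l //; exact: quotient_norm_le.
Qed.

(** As [G] vanishes on [Y], its value does not depend on the lift chosen by [repr]; lifts of almost
    minimal norm give the bound. *)
Lemma dual_pushforward (Y : closedSubspace X) (G : dual X) :
  (forall y, y \in Y -> G y = 0) ->
  exists g : dual (quotient_space Y),
    `|g| <= `|G| /\ forall x, g (quotient_proj Y x) = G x.
Proof.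
move=> G0.
have Grepr x : G (repr (quotient_proj Y x)) = G x.
  apply/eqP; rewrite -subr_eq0 -dualfB G0 //.
  by apply/quotient_projP; exact: reprK.
have [|q|g [gG gE]] := @dual_of_bounded _ (quotient_space Y)
    (fun q => G (repr q)) `|G| (normr_ge0 _).
- move=> a p q; have [x <-] := quotient_proj_surj p.
  have [y <-] := quotient_proj_surj q.
  by rewrite -linearP !Grepr dualfD dualfZ.
- apply/ler_addgt0Pr => e e0.
  have G1 : 0 < `|G| + 1 by rewrite ltr_wpDl.
  have [x [<- xe]] := quotient_norm_lt q (divr_gt0 e0 G1).
  rewrite Grepr (le_trans (ler_norm _)) // (le_trans (dual_bound G _)) //.
  apply: (le_trans (ler_wpM2l (normr_ge0 G) (ltW xe))).
  rewrite mulrDr lerD2l mulrA ler_pdivrMr // mulrC ler_wpM2l ?(ltW e0) //.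
  by rewrite lerDl.
by exists g; split=> // x; rewrite gE Grepr.
Qed.

End SubspaceDuality.

(** * Adjoining one vector to a reflexive subspace *)

Section AdjoinVector.
Context {R : realType} {X : normedModType R}.
Variables (Y : closedSubspace X) (x : X) (phi : dual X).
Hypotheses (phiY : forall y, y \in Y -> phi y = 0) (phix : phi x = 1).

Let proj (w : X) : X := w - phi w *: x.

(** As [phi] vanishes on [Y] and equals 1 at [x], this is the sum of [Y] and the line through [x],
    written as a preimage under a continuous map so that it is closed. *)
Let adjoin_pred : {pred X} := fun w => proj w \in Y.

Let projP a u v : proj (a *: u + v) = a *: proj u + proj v.
Proof.
rewrite /proj dualfD dualfZ scalerDl scalerBr -scalerA opprD.
by rewrite addrACA.
Qed.

Let adjoin_submod_closed : submod_closed adjoin_pred.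
Proof.
split=> [|a u v uY vY].
  by rewrite -topredE /= /adjoin_pred /proj dualf0 scale0r subr0 rpred0.
by rewrite -topredE /= /adjoin_pred projP rpredD // rpredZ.
Qed.

Let proj_continuous : continuous proj.
Proof.
move=> w; apply: cvgB; first exact: cvg_id.
by apply: cvgZl; exact: dual_continuous.
Qed.

Let adjoin_closed : closed [set` adjoin_pred].
Proof.
have -> : [set` adjoin_pred] = proj @^-1` [set` subspace_pred Y] by [].
by apply: closed_comp (@subspace_closed _ _ Y) => w _; exact: proj_continuous.
Qed.

Definition adjoin : closedSubspace X :=
  ClosedSubspace adjoin_submod_closed adjoin_closed.

Lemma sub_adjoin y : y \in Y -> y \in adjoin.
Proof.
by move=> yY; rewrite -topredE /= /adjoin_pred /proj phiY // scale0r subr0.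
Qed.

Lemma mem_adjoin : x \in adjoin.
Proof. by rewrite -topredE /= /adjoin_pred /proj phix scale1r subrr rpred0. Qed.

(** Each [w] is [P w + phi w *: x], so [f] splits as [L r + f x' *: phi']. Composing [F] with [L]
    gives a functional represented by some [y] in [Y], and [F phi'] is the coefficient along [x]. *)
Lemma adjoin_reflexive :
  reflexive_space (subspace_of Y) -> reflexive_space (subspace_of adjoin).
Proof.
move=> Yr F.
pose P (w : subspace_of adjoin) : subspace_of Y := exist _ (proj (val w)) (valP w).
pose incl (y : subspace_of Y) : subspace_of adjoin :=
  exist _ (val y) (sub_adjoin (valP y)).
pose x' : subspace_of adjoin := exist _ x mem_adjoin.
have PP a u v : P (a *: u + v) = a *: P u + P v.
  by apply: subspace_ext; rewrite subspace_valP /= ?subspace_valP projP.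
pose C := 1 + `|phi| * `|x|.
have C0 : 0 <= C by rewrite addr_ge0 // mulr_ge0.
have PC w : `|P w| <= C * `|w|.
  change (`|proj (val w)| <= C * `|val w|).
  rewrite (le_trans (ler_normB _ _)) // mulrDl mul1r lerD2l normrZ mulrAC.
  by rewrite ler_wpM2r // dual_bound.
have /choice[L LP] (g : dual (subspace_of Y)) :
    exists l : dual (subspace_of adjoin),
      `|l| <= `|g| * C /\ forall w, l w = g (P w).
  apply: (@dual_of_bounded _ _ (fun w => g (P w))); first by rewrite mulr_ge0.
    by move=> a u v; rewrite PP dualfD dualfZ.
  move=> w; rewrite (le_trans (ler_norm _)) // (le_trans (dual_bound g _)) //.
  by rewrite -mulrA ler_wpM2l.
have [|||G [_ GP]] := @dual_of_bounded _ (dual (subspace_of Y)) (fun g => F (L g))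
    (`|F| * C).
- by rewrite mulr_ge0.
- move=> a g h; rewrite -[a *: F _]dualfZ -dualfD; congr (F _).
  by apply: dual_ext => w; rewrite dualDE dualZE !(proj2 (LP _)).
- move=> g; rewrite (le_trans (ler_norm _)) // (le_trans (dual_bound F _)) //.
  by rewrite -mulrA ler_wpM2l // mulrC; case: (LP g).
have [y Gy] := Yr G.
have [phi' [_ phi'P]] := dual_restriction adjoin phi.
exists (incl y + F phi' *: x') => f.
have [r [_ rP]] : exists r : dual (subspace_of Y),
    `|r| <= `|f| /\ forall y, r y = f (incl y).
  apply: (@dual_of_bounded _ (subspace_of Y) (fun y => f (incl y))) => //.
    move=> a u v; rewrite -[a *: f _]dualfZ -dualfD; congr (f _).
    by apply: subspace_ext; rewrite subspace_valP /= ?subspace_valP.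
  by move=> u; rewrite (le_trans (ler_norm _)) //; exact: (dual_bound f (incl u)).
have fE : f = L r + f x' *: phi'.
  apply: dual_ext => w; rewrite dualDE dualZE (proj2 (LP r)) rP phi'P mulrC.
  rewrite -dualfZ -dualfD; congr (f _); apply: subspace_ext.
  by rewrite addrC subspace_valP /= addrC subrK.
by rewrite {1}fE dualfD dualfZ -GP Gy rP dualfD dualfZ mulrC.
Qed.

End AdjoinVector.

(** For [x] outside [Y], a functional norming the class of [x] pulls back to one that vanishes on
    [Y] but not at [x]; scaling it gives [phi]. *)
Lemma reflexive_adjoin {R : realType} {X : normedModType R}
    (Y : closedSubspace X) (x : X) : reflexive_space (subspace_of Y) ->
  exists Z : closedSubspace X,
    [/\ reflexive_space (subspace_of Z), x \in Z & {subset Y <= Z}].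
Proof.
move=> Yr; have [xY|xY] := boolP (x \in Y); first by exists Y; split=> // y.
have [g [_ gx]] := norming_functional (quotient_proj Y x).
have [G [_ GE]] := dual_pullback g.
have Gx : G x != 0.
  rewrite GE gx normr_eq0; apply: contra xY => /eqP x0.
  rewrite -[x]subr0; apply/quotient_projP; by rewrite x0 raddf0.
pose phi : dual X := (G x)^-1 *: G.
have phix : phi x = 1 by rewrite dualZE mulVf.
have phiY y : y \in Y -> phi y = 0.
  move=> yY; rewrite dualZE [G y]GE (_ : quotient_proj Y y = 0) ?dualf0 ?mulr0 //.
  by rewrite -(raddf0 (quotient_proj Y)); apply/quotient_projP; rewrite subr0.
exists (adjoin Y x phi); split; first exact: adjoin_reflexive.
- exact: mem_adjoin.
- by move=> y; exact: sub_adjoin.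
Qed.

(** * Distant pairs in convex combinations of slices *)

Section AverageRoughPairs.
Context {R : realType} {Z : normedModType R}.

(** The diameter is a supremum, so any [c] below [e] is exceeded by an actual pair; [enum_val]
    passes from ordinals to an arbitrary finite type. *)
Lemma average_rough_pair (e c : R) (I : finType) (lambda : I -> R)
    (S : I -> set (dual Z)) : average_rough Z e -> c < e ->
  (forall i, 0 < lambda i) -> \sum_i lambda i = 1 ->
  (forall i, is_wslice (S i)) ->
  exists s t : I -> dual Z, [/\ forall i, S i (s i), forall i, S i (t i) &
    c < `|\sum_i lambda i *: s i - \sum_i lambda i *: t i|].
Proof.
move=> rough ce lambda0 lambda1 Sw.
have reindexE (V : nmodType) (F : I -> V) :
    \sum_(k < #|I|) F (enum_val k) = \sum_i F i.
  by rewrite -(big_enum_val (fun i => F i)); apply: eq_bigl.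
have := rough #|I| (fun k => lambda (enum_val k)) (fun k => S (enum_val k))
  (fun k => lambda0 _) (etrans (reindexE _ lambda) lambda1) (fun k => Sw _).
have ceE : (c%:E < e%:E)%E by rewrite lte_fin.
move=> /(lt_le_trans ceE) /ereal_sup_gt.
move=> [_ [[_ _] [[s Ss <-] [t St <-]] <-]]; rewrite lte_fin /= => ct.
have rankE (u : 'I_#|I| -> dual Z) :
    \sum_i lambda i *: u (enum_rank i) = \sum_(k < #|I|) lambda (enum_val k) *: u k.
  rewrite -(reindexE _ (fun i => lambda i *: u (enum_rank i))).
  by apply: eq_bigr => k _; rewrite enum_valK.
exists (fun i => s (enum_rank i)), (fun i => t (enum_rank i)); split.
- by move=> i; have := Ss (enum_rank i); rewrite enum_rankK.
- by move=> i; have := St (enum_rank i); rewrite enum_rankK.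
- by rewrite !rankE.
Qed.

Lemma norm_convex_sum (I : finType) (mu : I -> R) (h : I -> dual Z) (c : R) :
  (forall i, 0 < mu i) -> \sum_i mu i = 1 -> (forall i, `|h i| <= c) ->
  `|\sum_i mu i *: h i| <= c.
Proof.
move=> mu0 mu1 hc; apply: (le_trans (ler_norm_sum _ _ _)).
rewrite -[c]mul1r -mu1 mulr_suml; apply: ler_sum => i _.
by rewrite normrZ gtr0_norm // ler_wpM2l // ltW.
Qed.

Lemma dual_sum (I : finType) (h : I -> dual Z) z :
  (\sum_i h i) z = \sum_i h i z.
Proof.
elim: (index_enum I) => [|i r IH]; first by rewrite !big_nil.
by rewrite !big_cons dualDE IH.
Qed.

End AverageRoughPairs.

(** * Lifting a slice of the quotient to a combination of slices *)

Section LiftSlice.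
Context {R : realType} {X : normedModType R} (Y : closedSubspace X).

(** Extending the restriction of [H] to [Y] gives [u] of norm at most [delta]; [H - u] vanishes on
    [Y], and dividing it by [1 + delta] returns it to the ball. *)
Lemma dual_near_annihilator (H : dual X) (delta : R) : 0 < delta -> `|H| <= 1 ->
  (forall y, y \in Y -> `|H y| <= delta * `|y|) ->
  exists K : dual X, [/\ `|K| <= 1, forall y, y \in Y -> K y = 0,
    `|H - K| <= 2 * delta & forall x, H x - delta * `|x| <= (1 + delta) * K x].
Proof.
move=> delta0 H1 HY.
have delta1 : 0 < 1 + delta by rewrite addr_gt0.
have [r [_ rH]] := dual_restriction Y H.
have rd : `|r| <= delta.
  apply: dual_norm_leM; first exact: ltW.
  by move=> y; rewrite rH (le_trans (ler_norm _)) // HY // (valP y).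
have [u [ur uE]] := dual_extension r.
have ud : `|u| <= delta := le_trans ur rd.
have nu : `|H - u| <= 1 + delta := le_trans (ler_normB _ _) (lerD H1 ud).
exists ((1 + delta)^-1 *: (H - u)); split.
- by rewrite normrZ gtr0_norm ?invr_gt0 // ler_pdivrMl // mulr1.
- move=> y yY; rewrite dualZE dualBE.
  by have /= -> := etrans (uE (exist _ y yY)) (rH _); rewrite subrr mulr0.
- have -> : H - (1 + delta)^-1 *: (H - u) = (1 + delta)^-1 *: (delta *: H + u).
    apply: (scalerI (lt0r_neq0 delta1)).
    rewrite scalerBr !scalerA divff ?gt_eqF // !scale1r scalerDl scale1r.
    by rewrite opprB addrC addrA subrK addrC.
  rewrite normrZ gtr0_norm ?invr_gt0 // ler_pdivrMl //.
  apply: (le_trans (ler_normD _ _)); rewrite normrZ (gtr0_norm delta0).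
  have h1 : delta * `|H| <= delta by rewrite ler_piMr // ltW.
  apply: (le_trans (lerD h1 ud)).
  by nra.
- move=> x; rewrite dualZE mulVKf ?gt_eqF // dualBE lerD2l lerN2.
  rewrite (le_trans (ler_norm _)) // (le_trans (dual_bound u _)) //.
  by rewrite ler_wpM2r.
Qed.

(** The slices are taken at the points of [Z] that define small slices of its dual ball. Restriction
    to [Z] sends each into its small slice, so the combination stays close on [Z] to [f], which
    vanishes on [Y] and takes at [x] the norm of [q]. *)
Lemma lift_slice (q : quotient_space Y) (alpha eta : R) :
  reflexive_space (subspace_of Y) -> 0 < alpha -> 0 < eta ->
  exists (I : finType) (mu : I -> R) (S : I -> set (dual X)),
    [/\ forall i, 0 < mu i, \sum_i mu i = 1, forall i, is_wslice (S i) &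
      forall h, (forall i, S i (h i)) ->
        exists (g : dual (quotient_space Y)) (G : dual X),
          [/\ wslice q alpha g, forall x, G x = g (quotient_proj Y x) &
              `|\sum_i mu i *: h i - G| <= eta]].
Proof.
move=> Yr alpha0 eta0; have [x xq] := quotient_proj_surj q.
have x1 : 0 < 4 * (`|x| + 1) by rewrite mulr_gt0 // ltr_wpDl.
(* The first bound controls the loss at [q], the second the displacement [2 * delta] of
   [dual_near_annihilator]. *)
pose delta := Num.min (alpha / (4 * (`|x| + 1))) (eta / 2).
have delta0 : 0 < delta by rewrite lt_min !divr_gt0.
have deltax : delta * (4 * (`|x| + 1)) <= alpha.
  by rewrite -ler_pdivlMr // ge_min lexx.
have deltae : 2 * delta <= eta.
  by rewrite -ler_pdivlMl // [_^-1 * _]mulrC ge_min lexx orbT.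
have [Z [Zr xZ YZ]] := reflexive_adjoin x Yr.
have [g0 [g01 g0q]] := norming_functional q.
have [f [fg0 fE]] := dual_pullback g0.
have [r [rf rE]] := dual_restriction Z f.
have r1 : `|r| <= 1 := le_trans rf (le_trans fg0 g01).
(* One half of [delta] bounds the small slices, the other the distance from [r] to their
   combination. *)
have delta2 : 0 < delta / 2 by rewrite divr_gt0.
have [k [I [mu [T [h0 [mu0 mu1 Tw Th kE]]]]] kr] :=
  small_slice_comb_dense Zr delta2 r1.
have /choice[za zaP] i : exists za : subspace_of Z * R,
    0 < za.2 /\ T i = wslice za.1 za.2.
  by have [z [a [a0 TE]]] := Tw i; exists (z, a).
exists I, mu, (fun i => wslice (val (za i).1) (za i).2); split=> // [i|h hS].
  by exists (val (za i).1), (za i).2; case: (zaP i).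
pose H := \sum_i mu i *: h i.
have h1 i : `|h i| <= 1 by have /wsliceP[] := hS i.
have H1 : `|H| <= 1 by exact: norm_convex_sum.
have HZ (w : subspace_of Z) : `|H (val w) - r w| <= delta * `|w|.
  have hw i : `|h i (val w) - h0 i w| <= delta / 2 * `|w|.
    have [s [sh sE]] := dual_restriction Z (h i).
    have Ts : T i s.
      rewrite (proj2 (zaP i)); apply/wsliceP; split; first exact: le_trans sh (h1 i).
      by rewrite sE; have /wsliceP[] := hS i.
    have sh0 := proj2 (Th i) _ Ts.
    rewrite -sE; apply: le_trans (dual_bound (s - h0 i) w) _.
    exact: ler_wpM2r.
  have Hk : `|H (val w) - k w| <= delta / 2 * `|w|.
    rewrite kE !dual_sum -sumrB; apply: (le_trans (ler_norm_sum _ _ _)).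
    have -> : delta / 2 * `|w| = \sum_i mu i * (delta / 2 * `|w|).
      by rewrite -mulr_suml mu1 mul1r.
    apply: ler_sum => i _.
    rewrite !dualZE -mulrBr normrM gtr0_norm // ler_wpM2l ?(ltW (mu0 i)) //; exact: hw.
  have kr' : `|k w - r w| <= delta / 2 * `|w|.
    apply: le_trans (dual_bound (k - r) w) _; apply: ler_wpM2r => //.
    by rewrite distrC ltW.
  rewrite [delta]splitr mulrDl; apply: le_trans (lerD Hk kr').
  exact: ler_distD.
have HY y : y \in Y -> `|H y| <= delta * `|y|.
  move=> yY; have := HZ (exist _ y (YZ _ yY)).
  rewrite rE /= fE (_ : quotient_proj Y y = 0) ?dualf0 ?subr0 //.
  by rewrite -(raddf0 (quotient_proj Y)); apply/quotient_projP; rewrite subr0.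
have [K [K1 KY HK Kx]] := dual_near_annihilator delta0 H1 HY.
have [g [gK gE]] := dual_pushforward KY.
exists g, K; split=> [|y|]; last exact: le_trans HK deltae.
  apply/wsliceP; split; first exact: le_trans gK K1.
  rewrite -{2}xq gE.
  have Hx : `|q| - delta * `|x| <= H x.
    have := HZ (exist _ x xZ); rewrite rE /= fE xq g0q ler_norml => /andP[+ _].
    by rewrite lerBrDr addrC.
  have qx : `|q| <= `|x| by rewrite -xq; exact: quotient_norm_le.
  have /= := Kx x.
  rewrite -(ltr_pM2l (_ : 0 < 1 + delta)) ?addr_gt0 // => Kx'.
  apply: lt_le_trans Kx'; apply: lt_le_trans (lerB Hx (lexx _)).
  (* It suffices that [d * b + 2 * d * c <= 3 * d * c < a]. *)
  have arith (a b c d : R) : 0 < a -> 0 < d -> 0 <= b -> b <= c ->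
    d * (4 * (c + 1)) <= a -> (1 + d) * (b - a) < b - d * c - d * c by clear; nra.
  exact: arith.
by rewrite gE.
Qed.

End LiftSlice.

(** * Roughness passes to the quotient *)

Lemma average_rough_quotient {R : realType} {X : normedModType R}
    (Y : closedSubspace X) (e : R) : reflexive_space (subspace_of Y) ->
  0 < e -> average_rough X e -> average_rough (quotient_space Y) (e / 2).
Proof.
move=> Yr e0 rough n lambda S lambda0 lambda1 Sw.
(* A pair more than [3 * e / 4] apart loses at most [e / 8] at each end, which leaves [e / 2]. *)
have eta0 : 0 < e / 8 by rewrite divr_gt0.
pose data := {I : finType & ((I -> R) * (I -> set (dual X)))%type}.
have /choice[D DP] i : exists D : data,
    [/\ forall j, 0 < (tagged D).1 j, \sum_j (tagged D).1 j = 1,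
        forall j, is_wslice ((tagged D).2 j) &
      forall h, (forall j, (tagged D).2 j (h j)) ->
        exists gG : dual (quotient_space Y) * dual X,
          [/\ S i gG.1, forall x, gG.2 x = gG.1 (quotient_proj Y x) &
              `|\sum_j (tagged D).1 j *: h j - gG.2| <= e / 8]].
  have [q [alpha [alpha0 ->]]] := Sw i.
  have [I [mu [T [mu0 mu1 Tw TP]]]] := lift_slice q Yr alpha0 eta0.
  exists (existT _ I (mu, T)); split=> //= h hT.
  by have [g [G gG]] := TP h hT; exists (g, G).
pose I i := tag (D i); pose mu i := (tagged (D i)).1.
pose T i := (tagged (D i)).2.
(* The combination of combinations becomes a single one, with product weights. *)
pose J : finType := {i : 'I_n & I i}.
pose lambdaJ (x : J) := lambda (tag x) * mu (tag x) (tagged x).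
pose TJ (x : J) := T (tag x) (tagged x).
have lambdaJ0 x : 0 < lambdaJ x.
  by rewrite mulr_gt0 //; case: (DP (tag x)) => + _ _ _; apply.
have sumJ (V : nmodType) (F : forall i, I i -> V) :
    \sum_(x : J) F (tag x) (tagged x) = \sum_i \sum_j F i j.
  by rewrite (sig_big_dep _ _ (fun i j => F i j)).
have lambdaJ1 : \sum_x lambdaJ x = 1.
  rewrite /lambdaJ (sumJ _ (fun i j => lambda i * mu i j)) -lambda1.
  apply: eq_bigr => i _; rewrite -mulr_sumr.
  by case: (DP i) => _ -> _ _; rewrite mulr1.
have TJw x : is_wslice (TJ x) by case: (DP (tag x)) => _ _ + _; apply.
have ce : 3 * e / 4 < e by lra.
have [s [t [sT tT st]]] := average_rough_pair rough ce lambdaJ0 lambdaJ1 TJw.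
have approx (u : J -> dual X) : (forall x, TJ x (u x)) ->
    exists g : 'I_n -> dual (quotient_space Y), exists G : dual X,
      [/\ forall i, S i (g i),
          forall x, G x = (\sum_i lambda i *: g i) (quotient_proj Y x) &
          `|\sum_x lambdaJ x *: u x - G| <= e / 8].
  move=> uT.
  have /choice[gG gGP] i : exists gG : dual (quotient_space Y) * dual X,
      [/\ S i gG.1, forall x, gG.2 x = gG.1 (quotient_proj Y x) &
        `|\sum_j mu i j *: u (existT _ i j) - gG.2| <= e / 8].
    by have [_ _ _] := DP i; apply=> j; exact: (uT (existT _ i j)).
  exists (fun i => (gG i).1), (\sum_i lambda i *: (gG i).2); split.
  - by move=> i; case: (gGP i).
  - move=> x; rewrite !dual_sum; apply: eq_bigr => i _; rewrite !dualZE.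
    by congr (_ * _); case: (gGP i).
  have -> : \sum_x lambdaJ x *: u x =
      \sum_i lambda i *: \sum_j mu i j *: u (existT _ i j).
    transitivity (\sum_i \sum_j (lambda i * mu i j) *: u (existT _ i j)).
      rewrite -(sumJ _ (fun i j => (lambda i * mu i j) *: u (existT _ i j))).
      by apply: eq_bigr => -[i j] _.
    apply: eq_bigr => i _; rewrite scaler_sumr.
    by apply: eq_bigr => j _; rewrite scalerA.
  rewrite -sumrB; under eq_bigr do rewrite -scalerBr.
  by apply: norm_convex_sum => // i; case: (gGP i).
have [g [G [gS gG sG]]] := approx s sT.
have [g' [G' [gS' gG' tG']]] := approx t tT.
(* [G - G'] is a functional on the quotient composed with the projection, which does not increase
   norms. *)
have GG' : `|G - G'| <=
    `|\sum_i lambda i *: g i - \sum_i lambda i *: g' i|.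
  apply: dual_norm_leM => // x; rewrite dualBE gG gG' -dualBE.
  rewrite (le_trans (ler_norm _)) // (le_trans (dual_bound _ _)) //.
  by rewrite ler_wpM2l //; exact: quotient_norm_le.
apply: (@le_trans _ _ (`|\sum_i lambda i *: g i - \sum_i lambda i *: g' i|%:E));
  last first.
  apply: ereal_sup_ubound.
  exists (\sum_i lambda i *: g i, \sum_i lambda i *: g' i) => //.
  by split; [exists g|exists g'].
rewrite lee_fin; apply: le_trans GG'.
have st1 := ler_distD G (\sum_x lambdaJ x *: s x) (\sum_x lambdaJ x *: t x).
have st2 := ler_distD G' G (\sum_x lambdaJ x *: t x).
rewrite [X in _ <= _ + X]distrC in st2.
have arith (a b c d f : R) : 3 * e / 4 < a -> a <= b + c -> c <= d + f ->
  b <= e / 8 -> f <= e / 8 -> e / 2 <= d by clear; lra.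
exact: arith st st1 st2 sG tG'.
Qed.

Theorem theorem2p15 (R : realType) (X : completeNormedModType R)
  (Y : closedSubspace X) :
  reflexive_space (subspace_of Y) ->
  average_non_rough (quotient_space Y) ->
  average_non_rough X.
Proof.
move=> Yr nonrough e e0 rough; apply: (nonrough (e / 2)); first by rewrite divr_gt0.
exact: average_rough_quotient.
Qed.
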